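(* Let $A$ be a unital associative $*$-algebra over $\mathbb{C}$, $\varepsilon\colon A\to\mathbb{C}$ a character and $K_1=\ker\varepsilon$. Let $\mu\colon K_1\otimes_A K_1\to K_1$, $\mu(a\otimes b)=ab$, be the multiplication map and let $'$ denote algebraic duals and transposes. Then there is an exact sequence of complex vector spaces \[ 0 \to H^1(A,\mathbb{C})\xrightarrow{\;R\;} K_1' \xrightarrow{\;\mu'\;} (K_1\otimes_A K_1)'\xrightarrow{\;L\;} H^2(A,\mathbb{C}) \to 0, \] where $R$ and $L$ are the canonical maps described in the context.
   Context: A character is a non-zero $*$-homomorphism $\varepsilon\colon A\to\mathbb{C}$. $H^n(A,\mathbb{C})$ is the Hochschild cohomology of $A$ with coefficients in the bimodule $\mathbb{C}$ with actions $a.z.b=\varepsilon(a)z\varepsilon(b)$: the cohomology of the complex $C^n(A,\mathbb{C})=\{\phi\colon A^{\otimes n}\to\mathbb{C}\ \text{linear}\}$ with \[ \partial\phi(a_1\otimes\dots\otimes a_n)=\varepsilon(a_1)\phi(a_2\otimes\dots\otimes a_n)+\sum_{i=1}^{n-1}(-1)^i\phi(a_1\otimes\dots\otimes a_ia_{i+1}\otimes\dots\otimes a_n)+(-1)^n\phi(a_1\otimes\dots\otimes a_{n-1})\varepsilon(a_n) \] for $\phi\in C^{n-1}(A,\mathbb{C})$. Since $B^1(A,\mathbb{C})=0$, $H^1(A,\mathbb{C})=Z^1(A,\mathbb{C})$ is the space of linear $\phi\colon A\to\mathbb{C}$ with $\phi(ab)=\varepsilon(a)\phi(b)+\phi(a)\varepsilon(b)$.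 The map $R$ is restriction, $R(\phi)=\phi|_{K_1}$. The map $L$ sends $S\in(K_1\otimes_A K_1)'$ to the class of the 2-cocycle $\hat S$ with $\hat S(a\otimes b)=S\big((a-\varepsilon(a)1)\otimes(b-\varepsilon(b)1)\big)$ for $a,b\in A$. *)

(* Defs.v *)
From HB Require Import structures.
From mathcomp Require Import all_boot all_order all_algebra.
From mathcomp Require Import generic_quotient ring_quotient finmap.
From mathcomp Require Import boolp classical_sets functions reals.
From mathcomp Require Import complex monalg.
From mathcomp Require Import ring.

Set Implicit Arguments.
Unset Strict Implicit.
Unset Printing Implicit Defensive.

Import GRing.Theory.
Local Open Scope ring_scope.
Local Open Scope quotient_scope.

Section LinearMaps.
Context {K : comNzRingType} {U V : lmodType K}.
Implicit Types f g : {linear U -> V}.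

Lemma linear_ext f g : (f : U -> V) =1 g -> f = g.
Proof.
move=> /funext; case: f g => [f [[fa] [fs]]] [g [[ga] [gs]]] /= efg.
move: fa fs; rewrite efg => fa fs.
by rewrite (Prop_irrelevance fa ga) (Prop_irrelevance fs gs).
Qed.

HB.instance Definition _ := gen_eqMixin {linear U -> V}.
HB.instance Definition _ := gen_choiceMixin {linear U -> V}.

Definition lin0 : {linear U -> V} := (\0 : U -> V).

Fact linD_subproof f g : linear (fun x => f x + g x).
Proof. by move=> a x y; rewrite !linearP scalerDr addrACA. Qed.
Definition linD f g : {linear U -> V} :=
  HB.pack (fun x => f x + g x) (GRing.isLinear.Build K U V *:%R _ (linD_subproof f g)).

Fact linN_subproof f : linear (fun x => - f x).
Proof. by move=> a x y; rewrite linearP opprD scalerN. Qed.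
Definition linN f : {linear U -> V} :=
  HB.pack (fun x => - f x) (GRing.isLinear.Build K U V *:%R _ (linN_subproof f)).

Fact linZ_subproof (c : K) f : linear (fun x => c *: f x).
Proof. by move=> a x y; rewrite linearP scalerDr !scalerA mulrC. Qed.
Definition linZ (c : K) f : {linear U -> V} :=
  HB.pack (fun x => c *: f x) (GRing.isLinear.Build K U V *:%R _ (linZ_subproof c f)).

Fact linA : associative linD.
Proof. by move=> f g h; apply: linear_ext => x /=; rewrite addrA. Qed.
Fact linC : commutative linD.
Proof. by move=> f g; apply: linear_ext => x /=; rewrite addrC. Qed.
Fact lin0D : left_id lin0 linD.
Proof. by move=> f; apply: linear_ext => x /=; rewrite add0r. Qed.
Fact linND : left_inverse lin0 linN linD.
Proof. by move=> f; apply: linear_ext => x /=; rewrite addNr. Qed.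
HB.instance Definition _ := GRing.isZmodule.Build {linear U -> V} linA linC lin0D linND.

Fact linZA a b f : linZ a (linZ b f) = linZ (a * b) f.
Proof. by apply: linear_ext => x /=; rewrite scalerA. Qed.
Fact linZ1 : left_id 1 linZ.
Proof. by move=> f; apply: linear_ext => x /=; rewrite scale1r. Qed.
Fact linZDr : right_distributive linZ +%R.
Proof. by move=> a f g; apply: linear_ext => x /=; rewrite scalerDr. Qed.
Fact linZDl f : {morph linZ^~ f : a b / a + b}.
Proof. by move=> a b; apply: linear_ext => x /=; rewrite scalerDl. Qed.
HB.instance Definition _ :=
  GRing.Zmodule_isLmodule.Build K {linear U -> V} linZA linZ1 linZDr linZDl.

Lemma lin_addE f g x : (f + g) x = f x + g x. Proof. by []. Qed.
Lemma lin_oppE f x : (- f) x = - f x. Proof. by []. Qed.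
Lemma lin_scaleE c f x : (c *: f) x = c *: f x. Proof. by []. Qed.
Lemma lin_0E x : (0 : {linear U -> V}) x = 0. Proof. by []. Qed.
End LinearMaps.

Definition dual (K : comNzRingType) (V : lmodType K) : lmodType K :=
  {linear V -> K^o}.

Section Transpose.
Context {K : comNzRingType} {U V : lmodType K} (f : {linear U -> V}).
Definition transpose_fun (phi : dual V) : dual U := phi \o f.
Fact transpose_linear : linear transpose_fun.
Proof. by move=> a x y; apply: linear_ext. Qed.
HB.instance Definition _ :=
  GRing.isLinear.Build K (dual V) (dual U) *:%R transpose_fun transpose_linear.
Definition transpose : {linear dual V -> dual U} := transpose_fun.
End Transpose.

Record subspace (K : comNzRingType) (V : lmodType K) := Subspace {
  subspace_pred :> {pred V};
  _ : submod_closed subspace_pred }.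

Section Subspaces.
Context {K : comNzRingType} {V : lmodType K} (W : subspace V).

Fact subspace_closed : submod_closed (subspace_pred W). Proof. by case: W. Qed.
HB.instance Definition _ :=
  GRing.isSubmodClosed.Build K V (subspace_pred W) subspace_closed.

Definition subspace_of : Type := {x : V | x \in subspace_pred W}.
HB.instance Definition _ := SubChoice.on subspace_of.
HB.instance Definition _ := [SubChoice_isSubLmodule of subspace_of by <:].

Definition quotient_space : Type := Quotient.quot (subspace_pred W).
HB.instance Definition _ := GRing.Zmodule.on quotient_space.

Definition class_fun (x : V) : quotient_space := \pi x.

Lemma class_eqP x y : class_fun x = class_fun y <-> x - y \in subspace_pred W.
Proof.
rewrite /class_fun; split; first by move/eqP; rewrite -Quotient.idealrBE.
by rewrite Quotient.idealrBE => /eqP.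
Qed.

Fact class_zmod : zmod_morphism class_fun.
Proof. by move=> x y; rewrite /class_fun raddfB. Qed.
HB.instance Definition _ := GRing.isZmodMorphism.Build V quotient_space class_fun class_zmod.

Lemma class_surj (q : quotient_space) : exists x, class_fun x = q.
Proof. by exists (repr q); rewrite /class_fun reprK. Qed.

Definition quotient_scale (c : K) (q : quotient_space) : quotient_space :=
  class_fun (c *: repr q).

Fact class_scale c x : quotient_scale c (class_fun x) = class_fun (c *: x).
Proof.
apply/class_eqP; rewrite -scalerBr rpredZ //.
by apply/class_eqP; rewrite /class_fun reprK.
Qed.

Fact quotient_scaleA a b q :
  quotient_scale a (quotient_scale b q) = quotient_scale (a * b) q.
Proof. by case: (class_surj q) => x <-; rewrite !class_scale scalerA. Qed.
Fact quotient_scale1 : left_id 1 quotient_scale.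
Proof. by move=> q; case: (class_surj q) => x <-; rewrite class_scale scale1r. Qed.
Fact quotient_scaleDr : right_distributive quotient_scale +%R.
Proof.
move=> c p q; case: (class_surj p) (class_surj q) => x <- [y <-].
by rewrite -raddfD !class_scale scalerDr raddfD.
Qed.
Fact quotient_scaleDl q : {morph quotient_scale^~ q : a b / a + b}.
Proof.
move=> a b; case: (class_surj q) => x <-.
by rewrite !class_scale scalerDl raddfD.
Qed.
HB.instance Definition _ := GRing.Zmodule_isLmodule.Build K quotient_space
  quotient_scaleA quotient_scale1 quotient_scaleDr quotient_scaleDl.

Fact class_scalable : scalable class_fun.
Proof. by move=> c x; rewrite -class_scale. Qed.
HB.instance Definition _ :=
  GRing.isScalable.Build K V quotient_space *:%R class_fun class_scalable.
Definition coset_class : {linear V -> quotient_space} := class_fun.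

Lemma classP x y : coset_class x = coset_class y <-> x - y \in subspace_pred W.
Proof. exact: class_eqP. Qed.

Lemma class_eq0 x : coset_class x = 0 <-> x \in subspace_pred W.
Proof. by rewrite -[0](linear0 coset_class) classP subr0. Qed.

Section Lift.
Context {U : lmodType K} (f : {linear V -> U}).
Hypothesis fW : forall x, x \in subspace_pred W -> f x = 0.

Definition lift_quotient_fun (q : quotient_space) : U := f (repr q).

Fact lift_quotient_fun_class x : lift_quotient_fun (coset_class x) = f x.
Proof.
apply/eqP; rewrite -subr_eq0 -linearB; apply/eqP/fW.
by apply/class_eqP; rewrite /class_fun reprK.
Qed.

Fact lift_quotient_linear : linear lift_quotient_fun.
Proof.
move=> a p q; case: (class_surj p) (class_surj q) => x <- [y <-].
by rewrite -[a *: _ + _](linearP coset_class) !lift_quotient_fun_class linearP.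
Qed.
HB.instance Definition _ :=
  GRing.isLinear.Build K quotient_space U *:%R lift_quotient_fun lift_quotient_linear.
Definition lift_quotient : {linear quotient_space -> U} := lift_quotient_fun.

Lemma lift_quotientE x : lift_quotient (coset_class x) = f x.
Proof. exact: lift_quotient_fun_class. Qed.
End Lift.
End Subspaces.

Section Kernel.
Context {K : comNzRingType} {U V : lmodType K} (f : {linear U -> V}).
Fact lkernel_closed : submod_closed [pred x | f x == 0].
Proof.
split=> [|a x y]; rewrite !inE ?linear0 // linearP.
by move=> /eqP -> /eqP ->; rewrite scaler0 addr0.
Qed.
Definition lkernel : subspace U := Subspace lkernel_closed.

Lemma lkernelP x : x \in subspace_pred lkernel <-> f x = 0.
Proof. by rewrite inE; split=> /eqP. Qed.

Fact limage_closed : submod_closed [pred y | `[< exists x, f x = y >]].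
Proof.
split=> [|a _ _ /asboolP[x <-] /asboolP[y <-]]; apply/asboolP.
  by exists 0; rewrite linear0.
by exists (a *: x + y); rewrite linearP.
Qed.
Definition limage : subspace V := Subspace limage_closed.
End Kernel.

Section Span.
Context {K : comNzRingType} {V : lmodType K} (S : set V).

Definition lspan_pred : {pred V} :=
  fun x => `[< forall W : subspace V, (forall s, S s -> s \in subspace_pred W) ->
                 x \in subspace_pred W >].
Fact lspan_closed : submod_closed lspan_pred.
Proof.
split=> [|a x y /asboolP Hx /asboolP Hy]; apply/asboolP => W SW.
  exact: (subspace_closed W).1.
by apply: (subspace_closed W).2; [exact: Hx | exact: Hy].
Qed.
Definition lspan : subspace V := Subspace lspan_closed.

Lemma lspan_gen s : S s -> s \in subspace_pred lspan.
Proof. by move=> Ss; apply/asboolP => W; apply. Qed.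

Lemma lspan_ind (W : subspace V) x :
  (forall s, S s -> s \in subspace_pred W) -> x \in subspace_pred lspan ->
  x \in subspace_pred W.
Proof. by move=> SW /asboolP; apply. Qed.
End Span.

Section Presentation.
Context {K : comNzRingType} {X : choiceType}.

Section FreeExtension.
Context {V : lmodType K} (f : X -> V).
Definition free_ext_fun (g : {malg K[X]}) : V :=
  \sum_(x <- msupp g) mcoeff x g *: f x.

Fact free_ext_funEw (d : {fset X}) g : (msupp g `<=` d)%fset ->
  free_ext_fun g = \sum_(x <- d) mcoeff x g *: f x.
Proof.
move=> le; rewrite [LHS](big_fset_incl _ le) => //= x xd /mcoeff_outdom ->.
by rewrite scale0r.
Qed.

Fact free_ext_linear : linear free_ext_fun.
Proof.
move=> a g h; set d := (msupp g `|` msupp h `|` msupp (a *: g + h))%fset.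
rewrite !(@free_ext_funEw d) ?fsubsetUr //.
- rewrite scaler_sumr -big_split /=; apply: eq_bigr => x _.
  by rewrite mcoeffD mcoeffZ scalerDl scalerA.
- by rewrite /d -fsetUA fsetUCA fsubsetUl.
- by rewrite /d -fsetUA fsubsetUl.
Qed.
HB.instance Definition _ :=
  GRing.isLinear.Build K {malg K[X]} V *:%R free_ext_fun free_ext_linear.
Definition free_ext : {linear {malg K[X]} -> V} := free_ext_fun.

Lemma free_extU x : free_ext (mkmalgU x 1) = f x.
Proof.
by rewrite /= (free_ext_funEw (msuppU_le)) big_seq_fset1 mcoeffUU scale1r.
Qed.
End FreeExtension.

Lemma free_linear_eq (V : lmodType K) (f g : {linear {malg K[X]} -> V}) :
  (forall x, f (mkmalgU x 1) = g (mkmalgU x 1)) -> f = g.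
Proof.
move=> efg; apply: linear_ext => v; rewrite [v]monalgE !linear_sum.
apply: eq_bigr => x _.
have -> : << v@_x *g x >> = v@_x *: << 1 *g x >> :> {malg K[X]}.
  by apply/malgP => y; rewrite mcoeffZ !mcoeffU mulr_natr.
by rewrite !linearZ efg.
Qed.

End Presentation.

Definition presented (K : comNzRingType) (X : choiceType)
  (Rel : set {malg K[X]}) : lmodType K := quotient_space (lspan Rel).

(* Locked so that unification does not unfold formal sums. *)
HB.lock Definition gen (K : comNzRingType) (X : choiceType)
  (Rel : set {malg K[X]}) (x : X) : presented Rel :=
  coset_class (lspan Rel) (mkmalgU x 1).

Section PresentationTheory.
Context {K : comNzRingType} {X : choiceType} (Rel : set {malg K[X]}).
Local Notation presented := (presented Rel).
Local Notation gen := (gen Rel).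

Lemma genE x : gen x = coset_class (lspan Rel) (mkmalgU x 1).
Proof. by rewrite gen.unlock. Qed.

Lemma presented_rel r : Rel r -> coset_class (lspan Rel) r = 0.
Proof. by move=> /lspan_gen ?; apply/class_eq0. Qed.

Section LiftPresented.
Context {V : lmodType K} (f : X -> V).
Hypothesis fRel : forall r, Rel r -> free_ext f r = 0.

Fact free_ext_span x : x \in subspace_pred (lspan Rel) -> free_ext f x = 0.
Proof.
move=> xs; apply/(lkernelP (free_ext f)); apply: lspan_ind xs => s /fRel.
by move/(lkernelP (free_ext f)).
Qed.
Definition lift_presented : {linear presented -> V} := lift_quotient free_ext_span.

Lemma lift_presentedE x : lift_presented (gen x) = f x.
Proof. by rewrite genE lift_quotientE free_extU. Qed.
End LiftPresented.

Lemma presented_ext (V : lmodType K) (f g : {linear presented -> V}) :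
  (forall x, f (gen x) = g (gen x)) -> f = g.
Proof.
move=> efg; apply: linear_ext => q; case: (class_surj q) => v <-.
suff : f \o coset_class (lspan Rel) = g \o coset_class (lspan Rel) :> {linear _ -> _}.
  by move=> /(congr1 (fun h : {linear _ -> _} => h v)).
by apply: free_linear_eq => x; have := efg x; rewrite !genE.
Qed.
End PresentationTheory.

Section Relative.
Context {K : comNzRingType} {V : lmodType K} (Z W : subspace V).
Fact relative_closed : submod_closed [pred z : subspace_of Z | val z \in subspace_pred W].
Proof.
split=> [|a x y]; rewrite !inE ?linear0; first exact: (subspace_closed W).1.
by rewrite linearP; apply: (subspace_closed W).2.
Qed.
Definition relative : subspace (subspace_of Z) := Subspace relative_closed.
End Relative.

Section BalancedTensor.
Context {K : comNzRingType} {A : algType K} {M N : lmodType K}.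
Variables (ract : M -> A -> M) (lact : A -> N -> N).

Local Notation free_pair m n :=
  (mkmalgU ((m : M), (n : N)) (1 : K) : {malg K[(M * N)%type]}).

(* [presented tensor_rel] is the tensor product over [A] of a right [A]-module
   [M] and a left [A]-module [N]. *)
Inductive tensor_rel : set {malg K[(M * N)%type]} :=
| tensor_rel_l c m m' n : tensor_rel
    (free_pair (c *: m + m') n - (c *: free_pair m n + free_pair m' n))
| tensor_rel_r c m n n' : tensor_rel
    (free_pair m (c *: n + n') - (c *: free_pair m n + free_pair m n'))
| tensor_rel_mid m a n : tensor_rel
    (free_pair (ract m a) n - free_pair m (lact a n)).

Definition tensor : lmodType K := presented tensor_rel.
Definition tens (m : M) (n : N) : tensor := gen tensor_rel (m, n).

Lemma tens_linearl c m m' n :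
  tens (c *: m + m') n = c *: tens m n + tens m' n.
Proof.
apply/eqP; rewrite -subr_eq0 /tens !genE -linearZ -linearD -linearB; apply/eqP.
exact/presented_rel/tensor_rel_l.
Qed.

Lemma tens_linearr c m n n' :
  tens m (c *: n + n') = c *: tens m n + tens m n'.
Proof.
apply/eqP; rewrite -subr_eq0 /tens !genE -linearZ -linearD -linearB; apply/eqP.
exact/presented_rel/tensor_rel_r.
Qed.

Lemma tens_mid m a n : tens (ract m a) n = tens m (lact a n).
Proof.
apply/eqP; rewrite -subr_eq0 /tens !genE -linearB; apply/eqP.
exact/presented_rel/tensor_rel_mid.
Qed.

Lemma tensor_ext (V : lmodType K) (f g : {linear tensor -> V}) :
  (forall m n, f (tens m n) = g (tens m n)) -> f = g.
Proof. by move=> efg; apply: presented_ext => -[m n]; apply: efg. Qed.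

Section LiftTensor.
Context {V : lmodType K} (f : M -> N -> V).
Hypothesis f_linearl : forall n, linear (f^~ n).
Hypothesis f_linearr : forall m, linear (f m).
Hypothesis f_mid : forall m a n, f (ract m a) n = f m (lact a n).

Fact lift_tensor_rel r :
  tensor_rel r -> free_ext (fun p : M * N => f p.1 p.2) r = 0.
Proof.
case=> [c m m' n|c m n n'|m a n]; apply/eqP; rewrite linearB subr_eq0;
  apply/eqP; rewrite ?(linearD, linearZ) !free_extU /=.
- exact: f_linearl.
- exact: f_linearr.
- exact: f_mid.
Qed.
Definition lift_tensor : {linear tensor -> V} := lift_presented lift_tensor_rel.
Lemma lift_tensorE m n : lift_tensor (tens m n) = f m n.
Proof. exact: lift_presentedE. Qed.
End LiftTensor.
End BalancedTensor.

Section TensorPower.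
Context {K : comNzRingType} {A : lmodType K} {n : nat}.
Implicit Types f g h : {ffun 'I_n -> A}.

(* [h] is the combination [c f + g] in the slot [j], where [f], [g] and [h]
   agree in all other slots. *)
Definition slot_comb (j : 'I_n) (c : K) f g h : Prop :=
  (forall i, i != j -> f i = h i /\ g i = h i) /\ h j = c *: f j + g j.

(* [presented tpow_rel] is the [n]-fold tensor power of [A] over [K]; the pure
   tensor of a family [f] is [tpure f]. *)
Inductive tpow_rel : set {malg K[{ffun 'I_n -> A}]} :=
| TpowRel j c f g h : slot_comb j c f g h ->
    tpow_rel (mkmalgU h 1 - (c *: mkmalgU f 1 + mkmalgU g 1)).

Definition tpow_space : lmodType K := presented tpow_rel.
Definition tpure (f : {ffun 'I_n -> A}) : tpow_space := gen tpow_rel f.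

Definition multilinear (V : lmodType K) (F : {ffun 'I_n -> A} -> V) : Prop :=
  forall j c f g h, slot_comb j c f g h -> F h = c *: F f + F g.

Lemma tpure_multilinear : multilinear tpure.
Proof.
move=> j c f g h E.
apply/eqP; rewrite -subr_eq0 /tpure !genE -linearZ -linearD -linearB; apply/eqP.
exact/presented_rel/(TpowRel E).
Qed.

Lemma tpow_ext (V : lmodType K) (F G : {linear tpow_space -> V}) :
  (forall f, F (tpure f) = G (tpure f)) -> F = G.
Proof. exact: presented_ext. Qed.

Section LiftTpow.
Context {V : lmodType K} {F : {ffun 'I_n -> A} -> V} (FM : multilinear F).
Fact lift_tpow_rel r : tpow_rel r -> free_ext F r = 0.
Proof.
case=> j c f g h E; rewrite linearB linearD linearZ !free_extU.
by rewrite (FM E) subrr.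
Qed.
Definition lift_tpow : {linear tpow_space -> V} := lift_presented lift_tpow_rel.
Lemma lift_tpowE f : lift_tpow (tpure f) = F f.
Proof. exact: lift_presentedE. Qed.
End LiftTpow.
End TensorPower.
Arguments tpow_space {K} A n.
Arguments tpure {K A n} f.

Section Faces.
Context {K : comNzRingType} {A : algType K} {n : nat}.
Implicit Types f g h a : {ffun 'I_n.+1 -> A}.

(* For [a = (a_0, ..., a_n)]: [face_tail a = (a_1, ..., a_n)],
   [face_init a = (a_0, ..., a_(n-1))], and [face_mul i a] is
   [(a_0, ..., a_i * a_(i+1), ..., a_n)]; [lift ord_max k] is [k] and
   [lift ord0 k] is [k + 1] in ['I_n.+1]. *)
Definition face_tail a : {ffun 'I_n -> A} := [ffun i => a (lift ord0 i)].
Definition face_init a : {ffun 'I_n -> A} := [ffun i => a (lift ord_max i)].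
Definition face_mul (i : 'I_n) a : {ffun 'I_n -> A} :=
  [ffun k : 'I_n => if (k < i)%N then a (lift ord_max k)
           else if k == i then a (lift ord_max i) * a (lift ord0 i)
           else a (lift ord0 k)].

Lemma slot_comb_ne (j : 'I_n.+1) c f g h i :
  slot_comb j c f g h -> i != j -> (f i = h i) * (g i = h i).
Proof. by case=> H _ /H[]. Qed.

Lemma slot_comb_tail (j : 'I_n) c f g h :
  slot_comb (lift ord0 j) c f g h ->
  slot_comb j c (face_tail f) (face_tail g) (face_tail h).
Proof.
move=> E; split=> [i ij|]; rewrite !ffunE; last exact: E.2.
by rewrite !(slot_comb_ne E) // (inj_eq lift_inj).
Qed.

Lemma slot_comb_init (j : 'I_n) c f g h :
  slot_comb (lift ord_max j) c f g h ->
  slot_comb j c (face_init f) (face_init g) (face_init h).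
Proof.
move=> E; split=> [i ij|]; rewrite !ffunE; last exact: E.2.
by rewrite !(slot_comb_ne E) // (inj_eq lift_inj).
Qed.

Lemma lift_max_neq0 (i j : 'I_n) : (j <= i)%N -> lift ord0 i != lift ord_max j.
Proof.
move=> ji; apply/eqP => /(congr1 (@nat_of_ord _)); rewrite lift0 lift_max => eij.
by rewrite -eij ltnn in ji.
Qed.

Lemma slot_comb_mul_max (i j : 'I_n) c f g h : (j <= i)%N ->
  slot_comb (lift ord_max j) c f g h ->
  slot_comb j c (face_mul i f) (face_mul i g) (face_mul i h).
Proof.
move=> ji E.
have E0 (k : 'I_n) : (j <= k)%N ->
    (f (lift ord0 k) = h (lift ord0 k)) * (g (lift ord0 k) = h (lift ord0 k)).
  by move=> jk; apply: (slot_comb_ne E); apply: lift_max_neq0.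
have Em (k : 'I_n) : k != j ->
    (f (lift ord_max k) = h (lift ord_max k)) *
    (g (lift ord_max k) = h (lift ord_max k)).
  by move=> kj; apply: (slot_comb_ne E); rewrite (inj_eq lift_inj).
split=> [k kj|]; rewrite !ffunE.
  case: ltnP => ki; first by rewrite !Em.
  case: eqVneq => [eki|ki']; first by rewrite -eki !(Em k kj) !E0 // eki.
  by rewrite !E0 //; apply: leq_trans ji ki.
case: ltnP => ij; first exact: E.2.
have -> : j = i by apply/val_inj/eqP; rewrite eqn_leq ji ij.
rewrite eqxx !E0 //.
have -> : i = j by apply/val_inj/eqP; rewrite eqn_leq ji ij.
by rewrite E.2 mulrDl -scalerAl.
Qed.

Lemma slot_comb_mul_0 (i j : 'I_n) c f g h : (i <= j)%N ->
  slot_comb (lift ord0 j) c f g h ->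
  slot_comb j c (face_mul i f) (face_mul i g) (face_mul i h).
Proof.
move=> ij E.
have Em (k : 'I_n) : (k <= j)%N ->
    (f (lift ord_max k) = h (lift ord_max k)) *
    (g (lift ord_max k) = h (lift ord_max k)).
  by move=> kj; apply: (slot_comb_ne E); rewrite eq_sym lift_max_neq0.
have E0 (k : 'I_n) : k != j ->
    (f (lift ord0 k) = h (lift ord0 k)) * (g (lift ord0 k) = h (lift ord0 k)).
  by move=> kj; apply: (slot_comb_ne E); rewrite (inj_eq lift_inj).
split=> [k kj|]; rewrite !ffunE.
  case: ltnP => ki; first by rewrite !Em // ltnW // (leq_trans ki).
  case: eqVneq => [eki|ki']; last by rewrite !E0.
  by rewrite -eki !(E0 k kj) !Em // eki.
rewrite ltnNge ij /=; case: eqVneq => [eji|ji]; last exact: E.2.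
by rewrite -eji !Em // E.2 mulrDr -scalerAr.
Qed.
End Faces.

(* A unital algebra morphism to the base ring, with [K^o] denoting [K] as a
   vector space over itself. *)
Record augmentation (K : comNzRingType) (A : algType K) := Augmentation {
  aug_fun :> {linear A -> K^o};
  augM : {morph aug_fun : a b / a * b};
  aug1 : aug_fun 1 = 1 }.

Section Hochschild.
Context {K : comNzRingType} {A : algType K}.
Variable eps : augmentation A.

Definition cochain (n : nat) : lmodType K := dual (tpow_space A n).

(* Entries are numbered from 0, so the summand [i] below multiplies the entries
   numbered [i + 1] and [i + 2] when counting from 1. *)
Definition coboundary_fun n (phi : cochain n) (a : {ffun 'I_n.+1 -> A}) : K^o :=
  eps (a ord0) * phi (tpure (face_tail a))
  + \sum_(i < n) (-1) ^+ i.+1 * phi (tpure (face_mul i a))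
  + (-1) ^+ n.+1 * (phi (tpure (face_init a)) * eps (a ord_max)).

Fact coboundary_multilinear n (phi : cochain n) :
  multilinear (coboundary_fun phi).
Proof.
move=> j c f g h E.
have phiE k f' g' h' : slot_comb k c f' g' h' ->
    phi (tpure h') = (c : K^o) * phi (tpure f') + phi (tpure g').
  by move=> E'; rewrite (tpure_multilinear E') linearP.
have epsE : eps (h j) = (c : K^o) * eps (f j) + eps (g j).
  by rewrite E.2 linearP.
rewrite /coboundary_fun -[c *: _]/((c : K^o) * _).
have -> : eps (h ord0) * phi (tpure (face_tail h)) =
    (c : K^o) * (eps (f ord0) * phi (tpure (face_tail f)))
    + eps (g ord0) * phi (tpure (face_tail g)).
  case: (unliftP ord0 j) => [j'|] ej.
    rewrite ej in E; rewrite !(slot_comb_ne E) ?neq_lift //.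
    by rewrite (phiE _ _ _ _ (slot_comb_tail E)) mulrDr mulrCA.
  have -> : face_tail f = face_tail h.
    by apply/ffunP => i; rewrite !ffunE (slot_comb_ne E) // ej eq_sym neq_lift.
  have -> : face_tail g = face_tail h.
    by apply/ffunP => i; rewrite !ffunE (slot_comb_ne E) // ej eq_sym neq_lift.
  by rewrite -ej epsE mulrDl mulrA.
have -> : phi (tpure (face_init h)) * eps (h ord_max) =
    (c : K^o) * (phi (tpure (face_init f)) * eps (f ord_max))
    + phi (tpure (face_init g)) * eps (g ord_max).
  case: (unliftP ord_max j) => [j'|] ej.
    rewrite ej in E; rewrite !(slot_comb_ne E) ?neq_lift //.
    by rewrite (phiE _ _ _ _ (slot_comb_init E)) mulrDl mulrA.
  have -> : face_init f = face_init h.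
    by apply/ffunP => i; rewrite !ffunE (slot_comb_ne E) // ej eq_sym neq_lift.
  have -> : face_init g = face_init h.
    by apply/ffunP => i; rewrite !ffunE (slot_comb_ne E) // ej eq_sym neq_lift.
  by rewrite -ej epsE mulrDr mulrCA.
have mulE (i : 'I_n) : phi (tpure (face_mul i h)) =
    (c : K^o) * phi (tpure (face_mul i f)) + phi (tpure (face_mul i g)).
  case: (leqP j i) => ji.
    have [j' ej] : exists j' : 'I_n, j = lift ord_max j'.
      case: (unliftP ord_max j) => [j' ->|ej]; first by exists j'.
      by move: ji; rewrite ej /= leqNgt ltn_ord.
    rewrite ej in E ji; apply: phiE; apply: slot_comb_mul_max E.
    by rewrite lift_max in ji.
  have [j' ej] : exists j' : 'I_n, j = lift ord0 j'.
    case: (unliftP ord0 j) => [j' ->|ej]; first by exists j'.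
    by move: ji; rewrite ej.
  rewrite ej in E ji; apply: phiE; apply: slot_comb_mul_0 E.
  by rewrite lift0 ltnS in ji.
have -> : \sum_(i < n) (-1) ^+ i.+1 * phi (tpure (face_mul i h)) =
    (c : K^o) * (\sum_(i < n) (-1) ^+ i.+1 * phi (tpure (face_mul i f)))
    + \sum_(i < n) (-1) ^+ i.+1 * phi (tpure (face_mul i g)).
  rewrite mulr_sumr -big_split /=; apply: eq_bigr => i _.
  by rewrite mulE mulrDr mulrCA.
ring.
Qed.

Definition coboundary_val n (phi : cochain n) : cochain n.+1 :=
  lift_tpow (coboundary_multilinear phi).

Lemma coboundary_valE n (phi : cochain n) a :
  coboundary_val phi (tpure a) = coboundary_fun phi a.
Proof. exact: lift_tpowE. Qed.

Fact coboundary_linear n : linear (@coboundary_val n).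
Proof.
move=> c phi psi; apply: tpow_ext => a.
rewrite lin_addE lin_scaleE !coboundary_valE /coboundary_fun.
under eq_bigr => i _ do rewrite lin_addE lin_scaleE mulrDr.
rewrite !lin_addE !lin_scaleE big_split /= -![c *: _]/((c : K^o) * _).
under eq_bigr => i _ do rewrite -[c *: _]/((c : K^o) * _) mulrCA.
rewrite -mulr_sumr; ring.
Qed.
HB.instance Definition _ n := GRing.isLinear.Build K (cochain n) (cochain n.+1)
  *:%R (@coboundary_val n) (@coboundary_linear n).
Definition coboundary n : {linear cochain n -> cochain n.+1} :=
  @coboundary_val n.

Lemma coboundaryE n (phi : cochain n) a :
  coboundary n phi (tpure a) = coboundary_fun phi a.
Proof. exact: lift_tpowE. Qed.

Definition cocycles n : subspace (cochain n) := lkernel (coboundary n).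
Definition coboundaries n : subspace (cochain n) :=
  match n with
  | 0 => lspan set0
  | m.+1 => limage (coboundary m)
  end.

(* Coboundaries are cocycles, so this is the quotient of the cocycles by the
   coboundaries; [relative Z B] is [B] as a subspace of [Z]. *)
Definition hochschild n : lmodType K :=
  quotient_space (relative (cocycles n) (coboundaries n)).
Definition cohomology_class n (z : subspace_of (cocycles n)) : hochschild n :=
  coset_class (relative (cocycles n) (coboundaries n)) z.

Definition tuple1 (a : A) : {ffun 'I_1 -> A} := [ffun => a].
Definition tuple2 (a b : A) : {ffun 'I_2 -> A} :=
  [ffun i => if i == ord0 then a else b].

Definition K1 : lmodType K := subspace_of (lkernel eps).

Lemma K1P (k : K1) : eps (val k) = 0.
Proof. by apply/lkernelP/(valP k). Qed.

Fact restrict_linear (z : subspace_of (cocycles 1)) :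
  linear (fun k : K1 => (val z : cochain 1) (tpure (tuple1 (val k)))).
Proof.
move=> c k l; rewrite -linearZ -linearD; congr (_ _).
apply: (tpure_multilinear (j := ord0)); split=> [i|]; rewrite ?ord1 //.
by rewrite !ffunE linearP.
Qed.
Definition restrict_cocycle z : dual K1 :=
  HB.pack (fun k : K1 => (val z : cochain 1) (tpure (tuple1 (val k))))
    (GRing.isLinear.Build K K1 K^o *:%R _ (restrict_linear z)).
Fact restrict_cocycle_linear : linear restrict_cocycle.
Proof. by move=> c y z; apply: linear_ext. Qed.
HB.instance Definition _ := GRing.isLinear.Build K _ (dual K1) *:%R
  restrict_cocycle restrict_cocycle_linear.

Fact restrict_cocycle_B (z : subspace_of (cocycles 1)) :
  z \in subspace_pred (relative (cocycles 1) (coboundaries 1)) ->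
  restrict_cocycle z = 0.
Proof.
move=> /asboolP[phi ephi]; apply: linear_ext => k /=.
rewrite -ephi coboundaryE /coboundary_fun big_ord0 !ffunE addr0 expr1 mulN1r.
have -> : face_tail (tuple1 (val k)) = face_init (tuple1 (val k)).
  by apply/ffunP => -[].
by rewrite mulrC subrr.
Qed.
(* The restriction map [H^1 -> K_1'], which kills the coboundaries of degree 1. *)
Definition R_map : {linear hochschild 1 -> dual K1} :=
  lift_quotient restrict_cocycle_B.

Lemma R_mapE z (k : K1) :
  R_map (cohomology_class z) k = (val z : cochain 1) (tpure (tuple1 (val k))).
Proof. by rewrite /R_map lift_quotientE. Qed.

Fact K1_mulr_proof (k : K1) (a : A) : val k * a \in subspace_pred (lkernel eps).
Proof. by apply/lkernelP; rewrite augM K1P mul0r. Qed.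
Definition K1_mulr (k : K1) (a : A) : K1 := Sub (val k * a) (K1_mulr_proof k a).
Fact K1_mull_proof (a : A) (k : K1) : a * val k \in subspace_pred (lkernel eps).
Proof. by apply/lkernelP; rewrite augM K1P mulr0. Qed.
Definition K1_mull (a : A) (k : K1) : K1 := Sub (a * val k) (K1_mull_proof a k).

Definition K1_tensor : lmodType K := tensor K1_mulr K1_mull.

Fact mu_l (l : K1) : linear ((fun k l => K1_mulr k (val l))^~ l).
Proof. by move=> c k k'; apply/val_inj; rewrite /= mulrDl -scalerAl. Qed.
Fact mu_r (k : K1) : linear (fun l : K1 => K1_mulr k (val l)).
Proof. by move=> c l l'; apply/val_inj; rewrite /= mulrDr -scalerAr. Qed.
Fact mu_mid (k : K1) a (l : K1) :
  K1_mulr (K1_mulr k a) (val l) = K1_mulr k (val (K1_mull a l)).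
Proof. by apply/val_inj; rewrite /= mulrA. Qed.
Definition mu : {linear K1_tensor -> K1} := lift_tensor mu_l mu_r mu_mid.

Lemma muE k l : val (mu (tens _ _ k l)) = val k * val l.
Proof. by rewrite lift_tensorE. Qed.

Fact center_proof (a : A) : a - (eps a : K) *: 1 \in subspace_pred (lkernel eps).
Proof.
apply/lkernelP; rewrite linearB linearZ aug1.
by apply/eqP; rewrite subr_eq0 eq_sym; apply/eqP; apply: mulr1.
Qed.
(* [a |-> a - eps a 1], with values in [K1]. *)
Definition center_fun (a : A) : K1 := Sub (a - (eps a : K) *: 1) (center_proof a).
Fact center_linear : linear center_fun.
Proof.
move=> c a b; apply/val_inj.
by rewrite /= linearP scalerBr scalerDl scalerA opprD addrACA.
Qed.
HB.instance Definition _ := GRing.isLinear.Build K A K1 *:%R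
  center_fun center_linear.
Definition center : {linear A -> K1} := center_fun.

Definition hat_fun (S : dual K1_tensor) (a : {ffun 'I_2 -> A}) : K^o :=
  S (tens K1_mulr K1_mull (center (a ord0)) (center (a ord_max))).

Fact hat_multilinear S : multilinear (hat_fun S).
Proof.
move=> j c f g h E; rewrite /hat_fun.
case: (unliftP ord0 j) => [j'|] ej.
  have {}ej : j = ord_max by rewrite ej ord1; apply/val_inj.
  rewrite ej in E; rewrite !(slot_comb_ne (i := ord0) E) //.
  by rewrite E.2 linearP tens_linearr linearP.
rewrite ej in E; rewrite !(slot_comb_ne (i := ord_max) E) //.
by rewrite E.2 linearP tens_linearl linearP.
Qed.
Definition hat (S : dual K1_tensor) : cochain 2 := lift_tpow (hat_multilinear S).

Lemma hatE S a b : hat S (tpure (tuple2 a b)) =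
  S (tens K1_mulr K1_mull (center a) (center b)).
Proof. by rewrite lift_tpowE /hat_fun !ffunE. Qed.

Lemma hat_tpure S f : hat S (tpure f) = hat_fun S f.
Proof. exact: lift_tpowE. Qed.

Fact center_mulr a b : center (a * b) = (eps a : K) *: center b + K1_mulr (center a) b.
Proof.
apply/val_inj; rewrite /= augM mulrBl -scalerAl mul1r scalerBr scalerA [RHS]addrC.
by rewrite addrA subrK.
Qed.

Fact center_mull a b : center (a * b) = (eps b : K) *: center a + K1_mull a (center b).
Proof.
apply/val_inj; rewrite /= augM mulrBr -scalerAr mulr1 scalerBr scalerA [RHS]addrC.
by rewrite addrA subrK [in RHS]mulrC.
Qed.

Fact hat_mulr (S : dual K1_tensor) (x y z : A) :
  S (tens K1_mulr K1_mull (center (x * y)) (center z)) =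
    eps x * S (tens K1_mulr K1_mull (center y) (center z))
    + S (tens K1_mulr K1_mull (K1_mulr (center x) y) (center z)) :> K^o.
Proof. by rewrite center_mulr tens_linearl; exact: (linearP S). Qed.

Fact hat_mull (S : dual K1_tensor) (x y z : A) :
  S (tens K1_mulr K1_mull (center x) (center (y * z))) =
    eps z * S (tens K1_mulr K1_mull (center x) (center y))
    + S (tens K1_mulr K1_mull (K1_mulr (center x) y) (center z)) :> K^o.
Proof. by rewrite center_mull tens_linearr tens_mid; exact: (linearP S). Qed.

Fact hat_cocycle S : hat S \in subspace_pred (cocycles 2).
Proof.
apply/lkernelP; apply: tpow_ext => a; rewrite lin_0E coboundaryE.
rewrite /coboundary_fun !big_ord_recl big_ord0 !hat_tpure /hat_fun !ffunE.
have -> : lift ord_max (ord0 : 'I_2) = ord0 by apply/val_inj.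
have -> : lift ord_max (lift ord0 (ord0 : 'I_1)) = lift ord0 ord0.
  exact/val_inj.
have -> : lift ord0 (ord_max : 'I_2) = ord_max by apply/val_inj.
have -> : lift ord_max (ord_max : 'I_2) = lift ord0 ord0 by apply/val_inj.
have -> : lift ord0 (lift ord0 (ord0 : 'I_1)) = ord_max by apply/val_inj.
rewrite /=.
move: (a ord0) (a (lift ord0 ord0)) (a ord_max) => x y z.
have hr := hat_mulr S x y z.
have hl := hat_mull S x y z.
rewrite /= in hr hl.
rewrite hr hl.
move: (S _) (S _) (S _) (eps x) (eps z) => r s t u v.
rewrite /bump /=; ring.
Qed.

Fact hat_linear : linear hat.
Proof.
move=> c S T; apply: tpow_ext => a.
by rewrite lin_addE lin_scaleE !hat_tpure.
Qed.

Definition hat_class (S : dual K1_tensor) : hochschild 2 :=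
  cohomology_class (Sub (hat S) (hat_cocycle S)).
Fact hat_class_linear : linear hat_class.
Proof.
move=> c S T; rewrite /hat_class /cohomology_class -linearZ -linearD.
by congr (coset_class _ _); apply/val_inj; rewrite /= hat_linear.
Qed.
HB.instance Definition _ := GRing.isLinear.Build K (dual K1_tensor) (hochschild 2)
  *:%R hat_class hat_class_linear.
Definition L_map : {linear dual K1_tensor -> hochschild 2} := hat_class.

End Hochschild.

Local Open Scope complex_scope.

HB.mixin Record isStarAlgebra (R : realType) A of GRing.Algebra R[i] A := {
  star : A -> A;
  starD : {morph star : x y / x + y};
  starZ : forall (c : R[i]) x, star (c *: x) = Num.conj c *: star x;
  starM : forall x y, star (x * y) = star y * star x;
  starK : involutive star }.

#[short(type="starAlgType")]
HB.structure Definition StarAlgebra (R : realType) :=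
  {A of GRing.Algebra R[i] A & isStarAlgebra R A}.

Record character (R : realType) (A : starAlgType R) := Character {
  char_fun :> A -> R[i];
  char_linear : linear (char_fun : A -> R[i]^o);
  char_mul : {morph char_fun : a b / a * b};
  char_star : forall a, char_fun (star a) = Num.conj (char_fun a);
  char_neq0 : exists a, char_fun a != 0 }.

Section CharacterAugmentation.
Context {R : realType} {A : starAlgType R} (eps : character A).

Definition char_lin : {linear A -> R[i]^o} :=
  HB.pack (char_fun eps : A -> R[i]^o)
    (GRing.isLinear.Build R[i] A R[i]^o *:%R _ (char_linear eps)).

(* Not assumed in [character]: it follows from multiplicativity and
   [char_neq0]. *)
Fact char1 : char_fun eps 1 = 1.
Proof.
have [a ea] := char_neq0 eps.
by apply: (mulIf ea); rewrite -char_mul !mul1r.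
Qed.

Definition char_augmentation : augmentation A :=
  @Augmentation _ A char_lin (char_mul eps) char1.
End CharacterAugmentation.
Coercion char_augmentation : character >-> augmentation.

(* Exactness at the middle space: the kernel of [g] is the range of [f]. *)
Definition exact_at (K : comNzRingType) (U V W : lmodType K)
    (f : {linear U -> V}) (g : {linear V -> W}) : Prop :=
  forall v, g v = 0 <-> exists u, f u = v.

(* Main.v *)
From HB Require Import structures.
Require Import Defs.
From mathcomp Require Import all_boot all_algebra boolp reals.
From mathcomp Require Import ring.

Set Implicit Arguments.
Unset Strict Implicit.
Unset Printing Implicit Defensive.

Import GRing.Theory.
Local Open Scope ring_scope.

(** The sequence is exact for any augmentation [eps] of an algebra [A] over a
    commutative ring [K], and a character is such an augmentation. Write
    [c(a) = a - eps(a) 1] for the projection of [A] onto [K1] along the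
    scalars. It satisfies
      [c(a b) = eps(a) c(b) + eps(b) c(a) + c(a) c(b)],
    so a functional [f] on [K1], extended to [A] as [f o c], has the coboundary
      [d(f o c) = - hat (mu' f)]
    ([coboundary_cochain1_center]). A 1-cochain [psi] has the form [f o c]
    exactly when [psi(1) = 0], that is, when [(d psi)(1, 1) = 0], and then [f]
    is its restriction to [K1] ([cocycle1_factor]). Finally, [hat] is
    injective because [c] maps onto [K1] ([hat_inj]). The first half of the
    sequence follows:
    - a cocycle of degree 1 is determined by its restriction to [K1];
    - [f] is the restriction of a cocycle iff [hat (mu' f) = 0], iff
      [mu' f = 0];
    - if [hat S = d psi], then [psi(1) = (hat S)(1, 1) = 0], so that
      [psi = f o c] and [S = mu' (- f)]; conversely [hat (mu' f) = d(- f o c)].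

    For the surjectivity of [L], let [phi] be a 2-cocycle. Evaluated at
    [(1, 1, b)] and at [(a, 1, 1)], the cocycle identity gives
    [phi(1, b) = phi(1, 1) eps(b)] and [phi(a, 1) = eps(a) phi(1, 1)]; evaluated
    at [(k, a, l)] with [k, l] in [K1], where the outer terms vanish, it says
    that [phi] is [A]-balanced on [K1], hence is given there by some [S] in
    the dual of the tensor product. Expanding [phi(c(a), c(b))] shows that
    [phi - hat S] is [phi(1, 1) eps(a) eps(b)], the coboundary of
    [phi(1, 1) eps] ([coboundary_scaled_eps]). *)

(** * Cochains of degrees 1 and 2 *)

(** The values of a functional are written with the product of [K] in place of
    the scaling of [K^o], so that they can be handled as ring elements. *)
Lemma dual_linear (K : comNzRingType) (V : lmodType K) (f : dual V) c x y :
  f (c *: x + y) = (c : K^o) * f x + f y.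
Proof. exact: linearP. Qed.

Lemma ord2P (i : 'I_2) : i = ord0 \/ i = ord_max.
Proof. by case: i => [[|[|//]]] ilt; [left|right]; apply/val_inj. Qed.

Section LowDegreeTensors.
Context {K : comNzRingType} {A : algType K}.

Lemma tuple1_ord0 (a : {ffun 'I_1 -> A}) : tuple1 (a ord0) = a.
Proof. by apply/ffunP => i; rewrite ffunE (ord1 i). Qed.

Lemma tuple2_eta (a : {ffun 'I_2 -> A}) : tuple2 (a ord0) (a ord_max) = a.
Proof. by apply/ffunP => i; rewrite ffunE; case: (ord2P i) => ->. Qed.

Definition pure1 (a : A) : tpow_space A 1 := tpure (tuple1 a).
Definition pure2 (a b : A) : tpow_space A 2 := tpure (tuple2 a b).

Fact pure1_linear : linear pure1.
Proof.
move=> c a b; apply: (tpure_multilinear (j := ord0)); split=> [i|].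
  by rewrite ord1.
by rewrite !ffunE.
Qed.
HB.instance Definition _ :=
  GRing.isLinear.Build K A (tpow_space A 1) *:%R pure1 pure1_linear.

Lemma pure2_linearl b : linear (pure2^~ b).
Proof.
move=> c a a'; apply: (tpure_multilinear (j := ord0)); split=> [i /negPf i0|].
  by rewrite !ffunE i0.
by rewrite !ffunE.
Qed.

Lemma pure2_linearr a : linear (pure2 a).
Proof.
move=> c b b'; apply: (tpure_multilinear (j := ord_max)); split=> [i|].
  by rewrite !ffunE; case: (ord2P i) => ->.
by rewrite !ffunE.
Qed.

Lemma tpow1_ext (V : lmodType K) (f g : {linear tpow_space A 1 -> V}) :
  (forall a, f (pure1 a) = g (pure1 a)) -> f = g.
Proof. by move=> efg; apply: tpow_ext => a; rewrite -[a]tuple1_ord0 efg. Qed.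

Lemma tpow2_ext (V : lmodType K) (f g : {linear tpow_space A 2 -> V}) :
  (forall a b, f (pure2 a b) = g (pure2 a b)) -> f = g.
Proof. by move=> efg; apply: tpow_ext => a; rewrite -[a]tuple2_eta efg. Qed.

Fact cochain1_multilinear (f : dual A) :
  multilinear (fun a : {ffun 'I_1 -> A} => f (a ord0)).
Proof. by move=> j c a b h [_]; rewrite !ord1 => ->; rewrite linearP. Qed.
Definition cochain1 (f : dual A) : @cochain K A 1 :=
  lift_tpow (cochain1_multilinear f).

Lemma cochain1E f a : cochain1 f (pure1 a) = f a.
Proof. by rewrite lift_tpowE ffunE. Qed.

End LowDegreeTensors.

(** * The coboundary and the projection onto the augmentation ideal *)

Section ExactSequence.
Context {K : comNzRingType} {A : algType K}.
Variable eps : augmentation A.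

Lemma coboundary1E (psi : @cochain K A 1) a b :
  coboundary eps 1 psi (pure2 a b) =
    eps a * psi (pure1 b) - psi (pure1 (a * b)) + psi (pure1 a) * eps b.
Proof.
rewrite coboundaryE /coboundary_fun big_ord1 expr1 mulN1r expr2 mulN1r opprK.
rewrite mul1r !ffunE /=.
have -> : face_tail (tuple2 a b) = tuple1 b.
  by apply/ffunP => i; rewrite !ffunE ord1.
have -> : face_init (tuple2 a b) = tuple1 a.
  by apply/ffunP => i; rewrite !ffunE ord1.
by have -> : face_mul ord0 (tuple2 a b) = tuple1 (a * b);
  first by apply/ffunP => i; rewrite !ffunE ord1.
Qed.

Definition tuple3 (a b c : A) : {ffun 'I_3 -> A} :=
  [ffun i : 'I_3 => if i == ord0 then a else if i == ord_max then c else b].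

Lemma coboundary2E (phi : @cochain K A 2) a b c :
  coboundary eps 2 phi (tpure (tuple3 a b c)) =
    eps a * phi (pure2 b c) - phi (pure2 (a * b) c) + phi (pure2 a (b * c))
    - phi (pure2 a b) * eps c.
Proof.
rewrite coboundaryE /coboundary_fun !big_ord_recl big_ord0 !ffunE /=.
have -> : face_tail (tuple3 a b c) = tuple2 b c.
  by apply/ffunP => i; rewrite !ffunE; case: (ord2P i) => ->.
have -> : face_init (tuple3 a b c) = tuple2 a b.
  by apply/ffunP => i; rewrite !ffunE; case: (ord2P i) => ->.
have -> : face_mul ord0 (tuple3 a b c) = tuple2 (a * b) c.
  by apply/ffunP => i; rewrite !ffunE; case: (ord2P i) => ->.
have -> : face_mul (lift ord0 ord0) (tuple3 a b c) = tuple2 a (b * c).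
  by apply/ffunP => i; rewrite !ffunE; case: (ord2P i) => ->.
rewrite /pure2.
move: (phi _) (phi _) (phi _) (phi _) (eps a) (eps c) => p q r s u v.
rewrite /bump /=; ring.
Qed.

Lemma center_val (k : K1 eps) : center eps (val k) = k.
Proof. by apply/val_inj; rewrite /= K1P scale0r subr0. Qed.

Lemma center1 : center eps 1 = 0.
Proof. by apply/val_inj; rewrite /= aug1 scale1r subrr. Qed.

Lemma val_center a : val (center eps a) = (- eps a : K) *: 1 + a.
Proof. by rewrite scaleNr addrC. Qed.

Lemma centerM a b : center eps (a * b) =
  (eps a : K) *: center eps b + (eps b : K) *: center eps a
  + K1_mulr (center eps a) (val (center eps b)).
Proof.
rewrite center_mulr -addrA; congr (_ + _); apply/val_inj => /=.
by rewrite mulrBr -scalerAr mulr1 [RHS]addrC subrK.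
Qed.

Definition restrict1 (psi : @cochain K A 1) : dual (K1 eps) :=
  psi \o (pure1 \o val).

(** The condition holds for cocycles and, by [hat_unit], for the 1-cochains
    that bound some [hat S]. It amounts to [psi(1) = 0], because the value of
    [d psi] at [(1, 1)] is [psi(1) - psi(1) + psi(1)]. *)
Lemma cocycle1_factor (psi : @cochain K A 1) :
  coboundary eps 1 psi (pure2 1 1) = 0 ->
  cochain1 (restrict1 psi \o center eps) = psi.
Proof.
rewrite coboundary1E mulr1 aug1 mul1r mulr1 subrr add0r => psi1.
apply: tpow1_ext => a; rewrite cochain1E.
rewrite -[LHS]/(psi (pure1 (val (center eps a)))).
by rewrite val_center pure1_linear dual_linear psi1 mulr0 add0r.
Qed.

Lemma transpose_mu_tens (f : dual (K1 eps)) (k l : K1 eps) :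
  transpose (mu eps) f (tens _ _ k l) = f (K1_mulr k (val l)).
Proof. by congr (f _); apply: lift_tensorE. Qed.

(** The terms [eps(a) f(c(b))] and [f(c(a)) eps(b)] of the coboundary cancel
    those that [centerM] produces from [f(c(a b))]. *)
Lemma coboundary_cochain1_center (f : dual (K1 eps)) :
  coboundary eps 1 (cochain1 (f \o center eps)) = - hat (transpose (mu eps) f).
Proof.
have fE a : cochain1 (f \o center eps) (pure1 a) = f (center eps a).
  exact: cochain1E.
apply: tpow2_ext => a b.
rewrite coboundary1E lin_oppE hatE transpose_mu_tens !fE.
have -> : f (center eps (a * b)) =
    eps a * f (center eps b) + (eps b * f (center eps a)
    + f (K1_mulr (center eps a) (val (center eps b)))) :> K^o.
  by rewrite centerM -addrA !dual_linear.
move: (f _) (f _) (f _) (eps a) (eps b) => x y z u v; ring.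
Qed.

Lemma hat_inj : injective (@hat K A eps).
Proof.
move=> S T eST; apply: tensor_ext => k l.
by rewrite -[k]center_val -[l]center_val -!hatE eST.
Qed.

Lemma hat_unit (S : dual (K1_tensor eps)) : hat S (pure2 1 1) = 0.
Proof.
rewrite hatE center1.
have -> : tens (@K1_mulr K A eps) (@K1_mull K A eps) 0 0 = 0.
  have := tens_linearl (@K1_mulr K A eps) (@K1_mull K A eps) (-1) 0 0 0.
  by rewrite scaler0 addr0 scaleN1r addNr.
exact: (linear0 S).
Qed.

Lemma cohomology_class_eq0 n (z : subspace_of (cocycles eps n)) :
  cohomology_class z = 0 <-> val z \in subspace_pred (coboundaries eps n).
Proof. exact: class_eq0. Qed.

Lemma L_map_eq0 (S : dual (K1_tensor eps)) :
  L_map eps S = 0 <-> exists psi, coboundary eps 1 psi = hat S.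
Proof.
split=> [/cohomology_class_eq0 /asboolP //|h].
by apply/cohomology_class_eq0/asboolP.
Qed.

(** * Exactness *)

Lemma R_map_inj : injective (R_map eps).
Proof.
apply: raddf_inj => c; case: (class_surj c) => z <- Rz.
have z0 : coboundary eps 1 (val z) = 0 by apply/lkernelP/(valP z).
have r0 : restrict1 (val z) = 0.
  apply: linear_ext => k; apply: etrans (esym (R_mapE z k)) _.
  exact: (congr1 (fun f : dual _ => f k) Rz).
apply/cohomology_class_eq0/asboolP; exists 0; rewrite linear0.
rewrite -[RHS]cocycle1_factor ?z0 // r0.
by apply: tpow1_ext => a; rewrite cochain1E.
Qed.

Lemma exact_R_mu : exact_at (R_map eps) (transpose (mu eps)).
Proof.
move=> f; split=> [f0|[c <-]].
  have fz : cochain1 (f \o center eps) \in subspace_pred (cocycles eps 1).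
    apply/lkernelP; rewrite coboundary_cochain1_center f0.
    by apply: tpow2_ext => a b; rewrite lin_oppE hatE oppr0.
  exists (cohomology_class (Sub (cochain1 (f \o center eps)) fz)).
  by apply: linear_ext => k; rewrite R_mapE cochain1E /= center_val.
case: (class_surj c) => z <-; apply: hat_inj.
have z0 : coboundary eps 1 (val z) = 0 by apply/lkernelP/(valP z).
have -> : R_map eps (class_fun _ z) = restrict1 (val z).
  by apply: linear_ext => k; exact: R_mapE.
apply: oppr_inj; rewrite -coboundary_cochain1_center cocycle1_factor ?z0 //.
by apply: tpow2_ext => a b; rewrite lin_oppE hatE oppr0.
Qed.

Lemma exact_mu_L : exact_at (transpose (mu eps)) (L_map eps).
Proof.
move=> S; rewrite L_map_eq0; split=> [[psi psiS]|[f <-]].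
  exists (- restrict1 psi); apply: hat_inj.
  rewrite -psiS -[psi in RHS]cocycle1_factor; last by rewrite psiS hat_unit.
  rewrite coboundary_cochain1_center.
  by apply: tpow2_ext => a b; rewrite lin_oppE !hatE linearN.
exists (- cochain1 (f \o center eps)).
by rewrite linearN coboundary_cochain1_center opprK.
Qed.

Section Surjectivity.
Variable phi : @cochain K A 2.
Hypothesis phi_cocycle : coboundary eps 2 phi = 0.

Lemma cocycle2E a b c :
  eps a * phi (pure2 b c) - phi (pure2 (a * b) c) + phi (pure2 a (b * c))
    - phi (pure2 a b) * eps c = 0.
Proof. by rewrite -coboundary2E phi_cocycle. Qed.

Lemma cocycle2_1l b : phi (pure2 1 b) = phi (pure2 1 1) * eps b.
Proof.
have := cocycle2E 1 1 b.
by rewrite aug1 !mul1r subrr add0r => /eqP; rewrite subr_eq0 => /eqP.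
Qed.

Lemma cocycle2_1r a : phi (pure2 a 1) = eps a * phi (pure2 1 1).
Proof.
have := cocycle2E a 1 1.
by rewrite aug1 !mulr1 addrK => /eqP; rewrite subr_eq0 => /eqP.
Qed.

(** At [(k, a, l)] the two terms of the cocycle identity that carry [eps k] or
    [eps l] vanish. *)
Fact cocycle2_mid (k : K1 eps) a (l : K1 eps) :
  phi (pure2 (val (K1_mulr k a)) (val l)) =
    phi (pure2 (val k) (val (K1_mull a l))).
Proof.
have := cocycle2E (val k) a (val l).
rewrite !K1P mul0r mulr0 subr0 add0r addrC => /eqP.
by rewrite subr_eq0 => /eqP.
Qed.

Fact cocycle2_l (l : K1 eps) :
  linear (fun k : K1 eps => phi (pure2 (val k) (val l))).
Proof. by move=> c k k'; rewrite linearP pure2_linearl linearP. Qed.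
Fact cocycle2_r (k : K1 eps) :
  linear (fun l : K1 eps => phi (pure2 (val k) (val l))).
Proof. by move=> c l l'; rewrite linearP pure2_linearr linearP. Qed.

(** A preimage under [L] of the class of [phi]. *)
Definition cocycle2_tensor : dual (K1_tensor eps) :=
  lift_tensor (f := fun k l : K1 eps => phi (pure2 (val k) (val l)))
    cocycle2_l cocycle2_r cocycle2_mid.

Lemma cocycle2_center a b :
  phi (pure2 (val (center eps a)) (val (center eps b))) =
    phi (pure2 a b) - phi (pure2 1 1) * (eps a * eps b).
Proof.
rewrite !val_center pure2_linearl !pure2_linearr !dual_linear.
rewrite (cocycle2_1l b) (cocycle2_1r a).
move: (phi _) (phi _) (eps a) (eps b) => x y u v; ring.
Qed.

Lemma coboundary_scaled_eps :
  coboundary eps 1 (- (phi (pure2 1 1) : K) *: cochain1 eps)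
    = hat cocycle2_tensor - phi.
Proof.
apply: tpow2_ext => a b; rewrite coboundary1E lin_addE lin_oppE hatE.
rewrite lift_tensorE cocycle2_center !lin_scaleE !cochain1E augM.
rewrite -![_ *: _]/((_ : K^o) * _) /=.
move: (phi _) (phi _) (eps a) (eps b) => x y u v; ring.
Qed.
End Surjectivity.

Lemma L_map_surj (c : hochschild eps 2) : exists S, L_map eps S = c.
Proof.
case: (class_surj c) => z <-.
have z0 : coboundary eps 2 (val z) = 0 by apply/lkernelP/(valP z).
exists (cocycle2_tensor z0); apply/classP/asboolP.
by eexists; exact: (coboundary_scaled_eps z0).
Qed.

End ExactSequence.

Theorem theorem3p3 (R : realType) (A : starAlgType R) (eps : character A) :
  [/\ injective (R_map eps),
      exact_at (R_map eps) (transpose (mu eps)),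
      exact_at (transpose (mu eps)) (L_map eps)
    & forall c : hochschild eps 2, exists S : dual (K1_tensor eps),
        L_map eps S = c].
Proof.
split.
- exact: R_map_inj.
- exact: exact_R_mu.
- exact: exact_mu_L.
- exact: L_map_surj.
Qed.
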